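(* Let $X$ and $Y$ be metric spaces and let $\phi:X\to Y$ be a coarse embedding. If $\operatorname{coasdim}(Y)\le fin+k$ for some $k\in\mathbb{N}$, then $\operatorname{coasdim}(X)\le fin+k$.
   Context: A map $f:X\to Y$ between metric spaces is a coarse embedding if there exist non-decreasing functions $\rho_1,\rho_2:[0,\infty)\to[0,\infty)$ with $\rho_i(t)\to+\infty$ as $t\to+\infty$ for $i=1,2$ and $\rho_1(d_X(x,x'))\le d_Y(f(x),f(x'))\le\rho_2(d_X(x,x'))$ for all $x,x'\in X$. For subsets $U,V$ of a metric space $(X,d)$, $\operatorname{diam}U=\sup\{d(x,y):x,y\in U\}$ and $d(U,V)=\inf\{d(x,y):x\in U,y\in V\}$. A family $\mathcal{U}$ of subsets is $R$-bounded if $\operatorname{diam}U\le R$ for all $U\in\mathcal{U}$, uniformly bounded if it is $R$-bounded for some $R>0$, and $r$-disjoint if $d(U,V)\ge r$ for all $U\ne V$ in $\mathcal{U}$. $\bigcup\mathcal{U}$ denotes the union of the members of $\mathcal{U}$. $\operatorname{asdim}X\le n$ means: for every $r>0$ there are uniformly bounded, $r$-disjoint families $\mathcal{U}_0,\dots,\mathcal{U}_n$ of subsets of $X$ such that $\bigcup_{i=0}^n\mathcal{U}_i$ covers $X$. $\operatorname{coasdim}(X)\le fin+k$ means that for every $n\in\mathbb{N}$ there exist $R>0$, $m\in\mathbb{N}$ and $n$-disjoint, $R$-bounded families $\mathcal{U}_1,\dots,\mathcal{U}_k$ of subsets of $X$ such that $\operatorname{asdim}\big(X\setminus\bigcup(\bigcup_{i=1}^k\mathcal{U}_i)\big)\le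 m$. *)

(* Defs.v *)
From HB Require Import structures.
From mathcomp Require Import all_boot all_order all_algebra.
From mathcomp Require Import all_classical all_reals all_analysis.

Set Implicit Arguments.
Unset Strict Implicit.
Unset Printing Implicit Defensive.

Import Order.TTheory GRing.Theory Num.Theory.

Local Open Scope classical_set_scope.
Local Open Scope ring_scope.

(* The library endows [set_type A] with a pseudometric only; the restriction of
   the distance of [X] makes it a metric space. *)
Section subset_metric.
Context {R : realType} {X : metricType R} (A : set X).

Let subdist (x y : A) : R := mdist (set_val x) (set_val y).

Let subdist_ge0 x y : 0 <= subdist x y.
Proof. exact: mdist_ge0. Qed.

Let subdist_positivity x y : subdist x y = 0 -> x = y.
Proof. by move=> /mdist_positivity /val_inj. Qed.

Let ballEsubdist (x : A) d : ball x d = [set y | subdist x y < d].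
Proof. by rewrite -[LHS]initial_ballE ballEmdist. Qed.

HB.instance Definition _ := @PseudoMetric_isMetric.Build R (set_type A)
  subdist subdist_ge0 subdist_positivity ballEsubdist.

End subset_metric.

Section coarse_geometry.
Context {R : realType}.

(* With values in [\bar R], [diam set0 = -oo] and [set_dist U V = +oo] whenever
   [U] or [V] is empty, so empty members of a family are never an obstruction. *)
Definition diam (X : metricType R) (U : set X) : \bar R :=
  ereal_sup [set (mdist x y)%:E | x in U & y in U].

Definition set_dist (X : metricType R) (U V : set X) : \bar R :=
  ereal_inf [set (mdist x y)%:E | x in U & y in V].

Definition bounded_family (X : metricType R) (r : R) (F : set (set X)) : Prop :=
  forall U, F U -> (diam U <= r%:E)%E.

Definition uniformly_bounded (X : metricType R) (F : set (set X)) : Prop :=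
  exists2 r : R, 0 < r & bounded_family r F.

Definition disjoint_family (X : metricType R) (r : R) (F : set (set X)) : Prop :=
  forall U V, F U -> F V -> U <> V -> (r%:E <= set_dist U V)%E.

Definition asdim_le (X : metricType R) (n : nat) : Prop :=
  forall r : R, 0 < r -> exists F : 'I_n.+1 -> set (set X),
    [/\ forall i, uniformly_bounded (F i),
        forall i, disjoint_family r (F i) &
        \bigcup_(U in \bigcup_i F i) U = [set: X]].

(* coasdim(X) <= fin + k; the complement carries the restricted metric. *)
Definition coasdim_le_fin (X : metricType R) (k : nat) : Prop :=
  forall n : nat, exists (r : R) (m : nat) (F : 'I_k -> set (set X)),
    [/\ 0 < r,
        forall i, disjoint_family n%:R (F i),
        forall i, bounded_family r (F i) &
        asdim_le (set_type (~` \bigcup_(U in \bigcup_i F i) U)) m].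

(* Functions [0, +oo[ -> [0, +oo[ are represented by functions on [R], of which
   only the values on [0, +oo[ are constrained. *)
Definition control_function (rho : R -> R) : Prop :=
  [/\ forall t : R, 0 <= t -> 0 <= rho t,
      forall s t : R, 0 <= s -> s <= t -> rho s <= rho t &
      rho t @[t --> +oo] --> +oo].

Definition coarse_embedding (X Y : metricType R) (f : X -> Y) : Prop :=
  exists rho1 rho2 : R -> R,
    [/\ control_function rho1, control_function rho2 &
        forall x x' : X,
          rho1 (mdist x x') <= mdist (f x) (f x') <= rho2 (mdist x x')].

End coarse_geometry.

(* Main.v *)
Require Import Defs.
From mathcomp Require Import all_boot all_order all_algebra.
From mathcomp Require Import all_classical all_reals all_analysis.

(** Families of subsets of [Y] are pulled back along [phi]: the upper control
    function turns sufficiently large disjointness in [Y] into any prescribed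
    disjointness in [X], and the lower one turns bounds in [Y] into bounds in
    [X].  The part of [X] left uncovered by the pulled back families is the
    preimage of the uncovered part of [Y]; the restriction of [phi] to it is
    again a coarse embedding, so the same argument bounds its asymptotic
    dimension. *)

Import Order.TTheory GRing.Theory Num.Theory.

Local Open Scope classical_set_scope.
Local Open Scope ring_scope.

Section preimage_families.
Context {R : realType} {X Y : metricType R} (phi : X -> Y).

Lemma coarse_embedding_expansion (r : R) : coarse_embedding phi -> 0 <= r ->
  exists s : R, forall x x', mdist x x' < r -> mdist (phi x) (phi x') < s.
Proof.
move=> [rho1 [rho2 [_ [_ rho2_mono _] phi_rho]]] r_ge0.
(* Adding 1 makes the bound by [rho2 r] strict. *)
exists (rho2 r + 1) => x x' xx'_lt_r; rewrite ltr_pwDr//.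
have /andP[_ /le_trans] := phi_rho x x'; apply.
by apply: rho2_mono; [exact: mdist_ge0|exact: ltW].
Qed.

Lemma coarse_embedding_proper (s : R) : coarse_embedding phi ->
  exists2 r : R, 0 < r &
    forall x x', mdist (phi x) (phi x') <= s -> mdist x x' <= r.
Proof.
move=> [rho1 [rho2 [[_ _ /cvgryPgt/(_ s) [M [_ rho1_gt]]] _ phi_rho]]].
(* As [rho1] tends to infinity, it exceeds [s] beyond [M]; the maximum with 1 secures positivity. *)
exists (Num.max M 1) => [|x x' le_s]; first by rewrite lt_max ltr01 orbT.
rewrite le_max leNgt; apply/orP; left; apply/negP => /rho1_gt /=.
have /andP[rho1_le _] := phi_rho x x'.
by rewrite ltNge (le_trans rho1_le le_s).
Qed.

(** Points of two preimages closer than [r] would have images closer than [s] in two members of [F],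
    which are distinct because their preimages are. *)
Lemma disjoint_family_preimage (r s : R) (F : set (set Y)) :
  (forall x x', mdist x x' < r -> mdist (phi x) (phi x') < s) ->
  disjoint_family s F -> disjoint_family r (preimage phi @` F).
Proof.
move=> phi_lt disjF _ _ [U FU <-] [V FV <-] UV.
apply/ereal_infP => _ [x Ux [y Vy <-]].
rewrite lee_fin leNgt; apply/negP => /phi_lt; apply/negP; rewrite -leNgt.
have UneqV : U <> V by move=> eqUV; apply: UV; rewrite eqUV.
rewrite -lee_fin; apply: le_trans (disjF U V FU FV UneqV) _.
by apply: ereal_inf_lbound; exists (phi x) => //; exists (phi y).
Qed.

Lemma bounded_family_preimage (r s : R) (F : set (set Y)) :
  (forall x x', mdist (phi x) (phi x') <= s -> mdist x x' <= r) ->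
  bounded_family s F -> bounded_family r (preimage phi @` F).
Proof.
move=> phi_le bndF _ [U FU <-].
apply/ereal_supP => _ [x Ux [y Uy <-]]; rewrite lee_fin; apply: phi_le.
rewrite -lee_fin; apply: le_trans (bndF U FU).
by apply: ereal_sup_ubound; exists (phi x) => //; exists (phi y).
Qed.

Lemma bigcup_preimage_family (I : Type) (F : I -> set (set Y)) :
  \bigcup_(U in \bigcup_i (preimage phi @` F i)) U =
  phi @^-1` (\bigcup_(V in \bigcup_i F i) V).
Proof.
apply/seteqP; split => [x [_ [i _ [V FV <-]] Vx]|x [V [i _ FV] Vx]].
  by exists V => //; exists i.
by exists (phi @^-1` V) => //; exists i => //; exists V.
Qed.

Lemma asdim_le_coarse_embedding (m : nat) :
  coarse_embedding phi -> asdim_le Y m -> asdim_le X m.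
Proof.
move=> phi_coarse asdimY r r_gt0.
have [s phi_lt] := coarse_embedding_expansion _ phi_coarse (ltW r_gt0).
(* [asdim_le] only accepts positive scales, and [phi_lt] survives enlarging [s]. *)
have [|F [bndF disjF covF]] := asdimY (Num.max s 1).
  by rewrite lt_max ltr01 orbT.
exists (fun i => preimage phi @` F i); split => [i|i|].
- have [t _ bndFi] := bndF i.
  have [t' t'_gt0 phi_le] := coarse_embedding_proper t phi_coarse.
  by exists t' => //; exact: bounded_family_preimage bndFi.
- apply: disjoint_family_preimage (disjF i) => x x' /phi_lt.
  by rewrite lt_max => ->.
- by rewrite bigcup_preimage_family covF preimage_setT.
Qed.

(** Subsets carry the restricted metrics, so the same control functions serve. *)
Lemma coarse_embedding_restrict (A : set X) (B : set Y)
    (AB : forall x : A, B (phi (set_val x))) :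
  coarse_embedding phi ->
  coarse_embedding (fun x : A => SigSub (mem_set (AB x)) : set_type B).
Proof.
move=> [rho1 [rho2 [rho1P rho2P phi_rho]]].
by exists rho1, rho2; split => // x x'; exact: phi_rho.
Qed.

End preimage_families.

Theorem proposition3p2 (R : realType) (X Y : metricType R) (phi : X -> Y)
    (k : nat) :
  coarse_embedding phi -> coasdim_le_fin Y k -> coasdim_le_fin X k.
Proof.
move=> phi_coarse coasdimY n.
have [s phi_lt] := coarse_embedding_expansion _ _ phi_coarse (ler0n R n).
(* Scales are natural numbers here; this one exceeds [s]. *)
have [t [m [F [_ disjF bndF asdimF]]]] := coasdimY (Num.truncn s).+1.
have [r r_gt0 phi_le] := coarse_embedding_proper _ t phi_coarse.
exists r, m, (fun i => preimage phi @` F i); split => // [i|i|].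
- apply: disjoint_family_preimage (disjF i) => x x' /phi_lt /lt_trans; apply.
  exact: truncnS_gt.
- exact: bounded_family_preimage (bndF i).
- rewrite bigcup_preimage_family.
  set C := \bigcup_(V in _) V in asdimF *.
  (* Complement and preimage commute by definition, so membership in the domain is already the
     claim. *)
  have phiC (x : ~` (phi @^-1` C)) : (~` C) (phi (set_val x)) := set_valP x.
  apply: asdim_le_coarse_embedding asdimF.
  exact: coarse_embedding_restrict phiC phi_coarse.
Qed.
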